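(* Let $G$ be a finitely generated group and let $A$ be a finite-dimensional vector space over a field $K$. Let $\Sigma \subset A^G$ be a linear subshift and let $\tau \colon \Sigma \to \Sigma$ be a linear cellular automaton, with limit set $\Omega(\tau) = \bigcap_{n \geq 1} \tau^n(\Sigma)$. Then the following hold: (i) $\Omega(\tau)$ is a linear subshift of $A^G$; (ii) $\tau(\Omega(\tau)) = \Omega(\tau)$; (iii) $\mathrm{Per}(\tau) \subset \mathrm{R}(\tau) \subset \mathrm{NW}(\tau) \subset \mathrm{CR}(\tau) \subset \Omega(\tau)$; (iv) if $\Omega(\tau)$ is of finite type then $\tau$ is stable; (v) if $\Omega(\tau)$ is finite-dimensional then $\tau$ is stable.
   Context: $A^G$ is the $K$-vector space of all maps $x \colon G \to A$, equipped with the prodiscrete uniform structure (product of the discrete uniform structures; a base of entourages is given by the sets $\{(x,y) : x|_F = y|_F\}$, $F \subset G$ finite) and the associated topology, and with the shift action of $G$ given by $(gx)(h) = x(g^{-1}h)$. A linear subshift of $A^G$ is a closed $G$-invariant vector subspace of $A^G$; it carries the induced uniform structure. It is of finite type if it equals $\{x \in A^G : (g^{-1}x)|_D \in P \text{ for all } g \in G\}$ for some finite $D \subset G$ and some $P \subset A^D$. A linear cellular automaton $A^G \to A^G$ is a map $\tilde\tau$ for which there exist a finite subset $M \subset G$ and a $K$-linear map $\mu \colon A^M \to A$ with $\tilde\tau(x)(g) = \mu((g^{-1}x)|_M)$ for all $x \in A^G$, $g \in G$. A linear cellular automaton $\tau \colon \Sigma \to \Sigma$ is a map that is the restriction of a linear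 cellular automaton $A^G \to A^G$. For a map $f \colon X \to X$: $f$ is stable if $f^{n+1}(X) = f^n(X)$ for some $n \geq 1$; $\mathrm{Per}(f) = \bigcup_{n \geq 1}\{x \in X : f^n(x) = x\}$. If $X$ is a topological space and $f$ is continuous, $\mathrm{R}(f)$ (recurrent points) is the set of $x$ such that for every neighborhood $U$ of $x$ there is $n \geq 1$ with $f^n(x) \in U$, and $\mathrm{NW}(f)$ (non-wandering points) is the set of $x$ such that for every neighborhood $U$ of $x$ there is $n \geq 1$ with $f^n(U) \cap U \neq \varnothing$. If $X$ is a uniform space and $f$ is uniformly continuous, $\mathrm{CR}(f)$ (chain-recurrent points) is the set of $x$ such that for every entourage $E$ there exist $n \geq 1$ and $x_0, \dots, x_n \in X$ with $x = x_0 = x_n$ and $(f(x_i), x_{i+1}) \in E$ for all $0 \leq i \leq n-1$. *)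

(* Defs.v *)
From HB Require Import structures.
From mathcomp Require Import all_boot all_order all_algebra finmap.
From mathcomp Require Import all_classical topology.

Set Implicit Arguments.
Unset Strict Implicit.
Unset Printing Implicit Defensive.

Import GRing.Theory.
Local Open Scope classical_set_scope.
Local Open Scope ring_scope.

Definition finitely_generated (G : groupType) : Prop :=
  exists2 S : set G, finite_set S &
    forall H : set G, group_closed (mem H) -> S `<=` H -> H = setT.

Definition finite_dimensional (K : fieldType) (V : lmodType K) (S : set V) :
    Prop :=
  exists (n : nat) (b : 'I_n -> V),
    S = [set \sum_i c i *: b i | c in [set: 'I_n -> K]].

Definition stable (X : Type) (f : X -> X) : Prop :=
  exists2 n : nat, (1 <= n)%N & range (iter n.+1 f) = range (iter n f).

Definition limit_set (X : Type) (f : X -> X) : set X :=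
  \bigcap_(n in [set n : nat | (1 <= n)%N]) range (iter n f).

Definition Per (X : Type) (f : X -> X) : set X :=
  \bigcup_(n in [set n : nat | (1 <= n)%N]) [set x | iter n f x = x].

Definition recurrent (X : topologicalType) (f : X -> X) : set X :=
  [set x | forall U : set X, nbhs x U ->
    exists2 n : nat, (1 <= n)%N & U (iter n f x)].

Definition nonwandering (X : topologicalType) (f : X -> X) : set X :=
  [set x | forall U : set X, nbhs x U ->
    exists2 n : nat, (1 <= n)%N & (iter n f @` U) `&` U !=set0].

(* Only the values c 0, ..., c n of the sequence c matter. *)
Definition chain_recurrent (X : uniformType) (f : X -> X) : set X :=
  [set x | forall E : set (X * X), entourage E ->
    exists n : nat, exists c : nat -> X,
      [/\ (1 <= n)%N, c 0%N = x, c n = x &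
          forall i : nat, (i < n)%N -> E (f (c i), c i.+1)]].

Definition config (G A : Type) : Type := G -> A.

HB.instance Definition _ (G : Type) (A : choiceType) :=
  Uniform.copy (config G A) (prod_topology (fun _ : G => discrete_topology A)).
HB.instance Definition _ (G : Type) (K : pzRingType) (A : lmodType K) :=
  GRing.Lmodule.copy (config G A) (G -> A).

Lemma config_entourageP (G A : choiceType) (E : set (config G A * config G A)) :
  entourage E <->
  exists F : {fset G},
    [set xy | forall h : G, h \in F -> xy.1 h = xy.2 h] `<=` E.
Proof.
split.
  case=> _ [F _ <-] FE.
  pose F1 : set G := [set (sval p).1 | p in [set` F]].
  have finF1 : finite_set F1 by apply: finite_image; exact: finite_fset.
  exists (fset_set F1) => -[x y] /= xyF.
  apply: FE.
  move=> -[[i V] /= iV] /= iVF.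
  have [W entW WV] := asboolW iV; apply: WV => /=.
  move: entW; rewrite uniform_discrete; apply => /=.
  exists (x i) => //; congr pair.
  change (x i = y i); apply: (xyF i); rewrite in_fset_set //; apply/mem_set.
  by exists (exist _ (i, V) iV).
case=> F FE; suff : entourage
    (\bigcap_(h in [set` F]) [set xy : config G A * config G A | xy.1 h = xy.2 h]).
  by apply: filterS => xy Fxy; apply: FE => h hF; exact: Fxy.
apply: filter_bigI => h hF; set V := [set _ | _].
have entV : @entourage (initial_topology
    (@proj G (fun _ => discrete_topology A) h)) V.
  exists [set ab | ab.1 = ab.2] => //.
  by rewrite uniform_discrete => _ [a _ <-].
exists V => //.
exists [fset (exist _ ((h : {classic G}), V) (asboolT entV))]%fset.
  by move=> ? _; exact: in_setT.
by apply/seteqP; split => [xy /(_ _ (fset11 _))//|xy xyV p];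
  rewrite /= inE => /eqP ->.
Qed.

Definition restr (G : choiceType) (A : Type) (D : {fset G}) (x : config G A) :
    D -> A :=
  fun d => x (val d).
Arguments restr {G A} D x _.

Section linear_subshifts.
Context (G : groupType) (K : fieldType) (A : vectType K).

Definition shift (g : G) (x : config G A) : config G A :=
  fun h => x (g^-1 * h)%g.

Definition linear_subshift (S : set (config G A)) : Prop :=
  [/\ closed S,
      forall (g : G) (x : config G A), S x -> S (shift g x) &
      submod_closed (mem S)].

Definition of_finite_type (S : set (config G A)) : Prop :=
  exists (D : {fset G}) (P : set (D -> A)),
    S = [set x | forall g : G, P (restr D (shift g^-1%g x))].

Definition linear_ca (t : config G A -> config G A) : Prop :=
  exists (M : {fset G}) (mu : {linear (M -> A) -> A}),
    forall (x : config G A) (g : G), t x g = mu (restr M (shift g^-1%g x)).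

Definition linear_ca_on (S : set (config G A)) (tau : S -> S) : Prop :=
  exists2 t : config G A -> config G A, linear_ca t &
    forall x : S, set_val (tau x) = t (set_val x).

End linear_subshifts.

(* Main.v *)
Require Import Defs.
From mathcomp Require Import all_boot all_order all_algebra finmap.
From mathcomp Require Import all_classical topology.

(** [A^G] is linearly compact: a downward directed family of nonempty closed
affine subspaces has a common point. Extend the family to a maximal filter base
of affine subspaces; on each coordinate line the base pins down a value, and
these values form the common point.

Compactness makes images of subshifts under linear cellular automata closed and
lifts points of [Omega] to preimages in [Omega], which gives (i) and (ii); in
(iii), a periodically repeated chain through [x] exhibits [x] as a limit of
points of the closed set [tau^n(Sigma)]. For (iv), the restrictions of the
[tau^n(Sigma)] to a finite window stabilise by dimension, to the restriction of
[Omega] by compactness; taking a defining window of [Omega] yields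
[tau^n(Sigma) = Omega]. For (v), a finite-dimensional subshift is determined by
its restriction to some finite [D], and a window containing [D] and its
translates by generators defines it, so (iv) applies. *)

Set Implicit Arguments.
Unset Strict Implicit.
Unset Printing Implicit Defensive.

Import GRing.Theory VectorInternalTheory.
Local Open Scope ring_scope.
Local Open Scope classical_set_scope.

(** * Maximal bases of affine subspaces *)

Definition affine (K : fieldType) (V : lmodType K) (S : set V) : Prop :=
  forall (k : K) (x y z : V), S x -> S y -> S z -> S (x + k *: (y - z)).

Definition affine_base (K : fieldType) (V : lmodType K) (B : set (set V)) :
    Prop :=
  [/\ B !=set0,
      forall X, B X -> affine X,
      forall X, B X -> X !=set0 &
      forall X Y, B X -> B Y -> B (X `&` Y)].

Lemma affineI (K : fieldType) (V : lmodType K) (X Y : set V) :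
  affine X -> affine Y -> affine (X `&` Y).
Proof.
move=> aX aY k x y z [Xx Yx] [Xy Yy] [Xz Yz].
by split; [exact: aX|exact: aY].
Qed.

(** Zorn's lemma is applied to the sets [E] whose union with [B] is an affine base; adjoining [B]
    also settles the empty chain. *)
Lemma affine_base_max (K : fieldType) (V : lmodType K) (B : set (set V)) :
  affine_base B ->
  exists M, [/\ affine_base M, B `<=` M &
    forall C, affine C -> (forall X, M X -> C `&` X !=set0) -> M C].
Proof.
move=> [B0 affB neB BI].
pose P (E : set (set V)) := affine_base (B `|` E).
have [F FP Ftot|E [[E0 affE neE EI] Emax]] := @Zorn_bigcup _ P.
  split.
  - by case: B0 => X BX; exists X; left.
  - move=> X [/affB//|[E FE EX]].
    by have [_ h _ _] := FP _ FE; apply: h; right.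
  - move=> X [/neB//|[E FE EX]].
    by have [_ _ h _] := FP _ FE; apply: h; right.
  - have sub E : F E -> B `|` E `<=` B `|` \bigcup_(X in F) X.
      by move=> FE X [BX|EX]; [left|right; exists E].
    move=> X Y [BX|[E FE EX]] [BY|[E' FE' EY]].
    + by left; exact: BI.
    + have [_ _ _ h] := FP _ FE'.
      by apply: (sub _ FE'); apply: h; [by left|by right].
    + have [_ _ _ h] := FP _ FE.
      by apply: (sub _ FE); apply: h; [by right|by left].
    + have [EE'|E'E] := Ftot _ _ FE FE'.
        have [_ _ _ h] := FP _ FE'.
        by apply: (sub _ FE'); apply: h; right => //; exact: EE'.
      have [_ _ _ h] := FP _ FE.
      by apply: (sub _ FE); apply: h; right => //; exact: E'E.
exists (B `|` E); split=> // C affC CE.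
(* [N] is the affine base generated by the maximal one and [C]. Its members are nonempty because [C]
   meets the whole base, so maximality forces [C] into it. *)
pose N := [set X : set V | affine X /\ exists2 Y, (B `|` E) Y & C `&` Y `<=` X].
have subN X : (B `|` E) X -> N X.
  by move=> EX; split; [exact: affE|exists X => // x []].
have NC : N C.
  by split=> //; case: E0 => Y EY; exists Y => // x [].
have PN : P N.
  rewrite /P (_ : B `|` N = N); last first.
    by apply/seteqP; split=> [X [BX|//]|X NX]; [apply: subN; left|right].
  split.
  - by exists C.
  - by move=> X [].
  - by move=> X [_ [Y /CE[x CYx] CYX]]; exists x; exact: CYX.
  - move=> X X' [aX [Y EY CYX]] [aX' [Y' EY' CYX']]; split; first exact: affineI.
    exists (Y `&` Y'); first exact: EI.
    by move=> x [Cx [Yx Y'x]]; split; [exact: CYX|exact: CYX'].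
apply: contrapT => nC; apply: (Emax N) => //; split.
  by move=> X EX; apply: subN; right.
by move=> NE; apply: nC; right; exact: NE.
Qed.

(* An affine subset of [K] is empty, a point or everything, so the traces of an
   affine base on a coordinate line always share a point. *)
Lemma affine_base_eval (K : fieldType) (V : lmodType K) (M : set (set V))
    (phi : V -> K) :
  affine_base M ->
  (forall k x y z, phi (x + k *: (y - z)) = phi x + k * (phi y - phi z)) ->
  exists a : K, forall X, M X -> [set x | phi x = a] `&` X !=set0.
Proof.
move=> [M0 affM neM MI] phiE.
have [[X [a [MX Xa]]]|nX] :=
    pselect (exists X a, M X /\ forall x, X x -> phi x = a).
  exists a => Y MY; have [x [Xx Yx]] := neM _ (MI _ _ MX MY).
  by exists x; split=> //=; exact: Xa.
(* Here [phi] is constant on no member, so it takes every value on each of them; 0 is an arbitrary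
   choice. *)
exists 0 => X MX; have [x Xx] := neM _ MX.
have [y [Xy yx]] : exists y, X y /\ phi y <> phi x.
  apply: contrapT => ny; apply: nX; exists X, (phi x); split=> // y Xy.
  by apply: contrapT => yx; apply: ny; exists y.
exists (x + (- phi x / (phi y - phi x)) *: (y - x)); split; last exact: affM.
rewrite /= phiE divfK ?subrr// subr_eq0; exact/eqP.
Qed.

(** * Prodiscrete topology and linear compactness *)

Lemma config_nbhsP (G A : choiceType) (x : config G A) (U : set (config G A)) :
  nbhs x U <-> exists F : {fset G},
    [set y | forall h, h \in F -> x h = y h] `<=` U.
Proof.
rewrite nbhsP; split.
  case=> E /config_entourageP[F FE] EU; exists F => y xy; apply: EU.
  by apply/mem_set; apply: FE.
case=> F FU; exists [set xy | forall h, h \in F -> xy.1 h = xy.2 h].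
  by apply/config_entourageP; exists F.
by move=> y; rewrite /xsection /= inE => /= xy; exact: FU.
Qed.

Lemma config_closedP (G A : choiceType) (S : set (config G A)) :
  closed S <-> forall x, (forall F : {fset G},
    exists2 y, S y & forall h, h \in F -> x h = y h) -> S x.
Proof.
split=> [cS x xS|cS x xS].
  apply: cS => U /config_nbhsP[F FU]; have [y Sy xy] := xS F.
  by exists y; split=> //; exact: FU.
apply: cS => F; have [|y [Sy xy]] := xS [set y | forall h, h \in F -> x h = y h].
  by apply/config_nbhsP; exists F.
by exists y.
Qed.

Lemma config_linearly_compact (G : choiceType) (K : fieldType) (A : vectType K)
    (B : set (set (config G A))) :
  affine_base B -> (forall X, B X -> closed X) ->
  exists x, forall X, B X -> X x.
Proof.
move=> bB cB; have [M [bM BM maxM]] := affine_base_max bB.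
pose phi (p : G * 'I_(dim A)) (x : config G A) : K := v2r (x p.1) 0 p.2.
have phiE p k x y z :
    phi p (x + k *: (y - z)) = phi p x + k * (phi p y - phi p z).
  by rewrite /phi [X in v2r X](_ : _ = x p.1 + k *: (y p.1 - z p.1))//
    linearD linearZ linearB !mxE.
(* By maximality, for each coordinate [p] some level set of [phi p] belongs to [M]. *)
have /choice[a Ma] : forall p, exists c : K, M [set x | phi p x = c].
  move=> p; have [c cM] := affine_base_eval bM (phiE p).
  exists c; apply: maxM => // k x y z /= xc yc zc.
  by rewrite phiE xc yc zc subrr mulr0 addr0.
have Ms (s : seq (G * 'I_(dim A))) :
    exists2 Y, M Y & Y `<=` [set x | forall p, p \in s -> phi p x = a p].
  case: bM => -[Y MY] _ _ MI.
  elim: s => [|p s [Y' MY' Y's]]; first by exists Y.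
  exists ([set x | phi p x = a p] `&` Y'); first exact: MI.
  by move=> x [/= xp Y'x] q; rewrite inE => /predU1P[->//|]; exact: Y's.
exists (fun g => r2v (\row_i a (g, i))) => X BX.
(* As [X] is closed, approximation on each finite window suffices. A window involves finitely many
   coordinates, so the intersection of their level sets contains a member of [M], which meets
   [X]. *)
apply/(config_closedP _).1; first exact: cB.
move=> F.
have [Y MY Ys] := Ms [seq (g, i) | g <- enum_fset F, i <- enum 'I_(dim A)].
have [_ _ neM MI] := bM.
have [x [Xx Yx]] := neM _ (MI _ _ (BM _ BX) MY).
exists x => // h hF; apply: (can_inj v2rK); rewrite r2vK.
apply/rowP => i; rewrite mxE; apply/esym/(Ys x Yx (h, i)).
by apply/allpairsP; exists (h, i); rewrite mem_enum.
Qed.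
Lemma decreasing_subset (T : Type) (X : nat -> set T) :
  (forall n, X n.+1 `<=` X n) ->
  forall m n, (m <= n)%N -> X n `<=` X m.
Proof.
move=> decX m n /subnK <-; elim: (n - m)%N => [//|k IH].
by rewrite addSn; apply: subset_trans (decX _) IH.
Qed.

Lemma config_closed_decreasing_meet (G : choiceType) (K : fieldType)
    (A : vectType K) (X : nat -> set (config G A)) :
  (forall n, closed (X n)) -> (forall n, affine (X n)) ->
  (forall n, X n !=set0) -> (forall n, X n.+1 `<=` X n) ->
  exists x, forall n, X n x.
Proof.
move=> cX aX neX decX.
have dec := decreasing_subset decX.
have [||x Xx] := @config_linearly_compact G K A (range X).
- split; [by exists (X 0%N), 0%N| by move=> _ [n _ <-]| by move=> _ [n _ <-]|].
  move=> _ _ [m _ <-] [n _ <-].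
  wlog mn : m n / (m <= n)%N => [th|].
    have [mn|/ltnW nm] := leqP m n; first exact: th.
    by rewrite setIC; exact: th.
  by exists n => //; rewrite setIC; apply/esym/setIidPl; exact: dec.
- by move=> _ [n _ <-].
- by exists x => n; apply: Xx; exists n.
Qed.

(** * Closed images under linear maps with finite windows *)

(** This is uniform continuity for the prodiscrete structure. *)
Definition finite_window (G : choiceType) (A : Type)
    (t : config G A -> config G A) : Prop :=
  forall F : {fset G}, exists F' : {fset G}, forall x y : config G A,
    (forall h, h \in F' -> x h = y h) -> forall h, h \in F -> t x h = t y h.

Lemma linear_affine (K : fieldType) (V W : lmodType K) (t : V -> W) k x y z :
  linear t -> t (x + k *: (y - z)) = t x + k *: (t y - t z).
Proof.
move=> lt; rewrite addrC lt -scaleN1r (addrC y) lt scaleN1r.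
by rewrite (addrC (- t z)) addrC.
Qed.

Lemma submod_affine (K : fieldType) (V : lmodType K) (S : set V) :
  submod_closed (mem S) -> affine S.
Proof.
move=> [_ lS] k x y z Sx Sy Sz; apply/set_mem; rewrite addrC; apply: (lS).
  by rewrite -scaleN1r addrC; apply: lS; exact/mem_set.
exact/mem_set.
Qed.

Lemma submod_image (K : fieldType) (V W : lmodType K) (t : V -> W)
    (S : set V) :
  linear t -> submod_closed (mem S) -> submod_closed (mem (t @` S)).
Proof.
move=> lt [S0 lS]; split.
  apply/mem_set; exists 0; first exact/set_mem.
  by have := lt (-1) 0 0; rewrite scaler0 addr0 scaleN1r addNr.
move=> a _ _ /set_mem[x Sx <-] /set_mem[y Sy <-]; apply/mem_set.
exists (a *: x + y); last exact: lt.
by apply/set_mem; apply: lS; exact/mem_set.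
Qed.

Lemma affine_preimage (K : fieldType) (V W : lmodType K) (t : V -> W)
    (S : set W) :
  linear t -> affine S -> affine (t @^-1` S).
Proof.
by move=> lt aS k x y z Sx Sy Sz; rewrite /preimage /= linear_affine//; exact: aS.
Qed.

Lemma affine_agree (G : choiceType) (K : fieldType) (A : lmodType K)
    (F : {fset G}) (x : config G A) :
  affine [set y : config G A | forall h, h \in F -> x h = y h].
Proof.
move=> k u v w xu xv xw h hF.
rewrite [RHS](_ : _ = u h + k *: (v h - w h))//.
by rewrite -xu// -xv// -xw// subrr scaler0 addr0.
Qed.

Lemma closed_agree (G A : choiceType) (F : {fset G}) (x : config G A) :
  closed [set y : config G A | forall h, h \in F -> x h = y h].
Proof.
apply/config_closedP => y yF h hF; have [z xz yz] := yF F.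
by rewrite xz// yz.
Qed.

Lemma finite_window_continuous (G A : choiceType)
    (t : config G A -> config G A) :
  finite_window t -> continuous t.
Proof.
move=> wt x U /config_nbhsP[F FU]; apply/config_nbhsP.
by have [F' tF'] := wt F; exists F' => y xy; apply: FU; exact: tF'.
Qed.

Lemma finite_window_closed_preimage (G A : choiceType)
    (t : config G A -> config G A) (S : set (config G A)) :
  finite_window t -> closed S -> closed (t @^-1` S).
Proof.
by move=> wt cS; apply: closed_comp => // x _; exact: finite_window_continuous.
Qed.

(** For [x] in the closure of the image, the points of [S] whose image agrees with [x] on [F] form a
    directed family of nonempty closed affine sets; a common point is a preimage of [x]. *)
Lemma closed_linear_image (G : choiceType) (K : fieldType) (A : vectType K)
    (t : config G A -> config G A) (S : set (config G A)) :
  linear t -> finite_window t -> affine S -> closed S -> closed (t @` S).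
Proof.
move=> lt wt aS cS; apply/config_closedP => x xS.
pose X (F : {fset G}) := S `&` t @^-1` [set y | forall h, h \in F -> x h = y h].
have [||y Xy] := @config_linearly_compact G K A (range X).
- split; first by exists (X fset0), fset0.
  + move=> _ [F _ <-]; apply: affineI => //; apply: affine_preimage => //.
    exact: affine_agree.
  + by move=> _ [F _ <-]; have [_ [y Sy <-] xy] := xS F; exists y.
  + move=> _ _ [F _ <-] [F' _ <-]; exists (F `|` F')%fset => //.
    apply/seteqP; split=> y /=.
      by move=> [Sy xy]; split; split=> // h hF; apply: xy;
        rewrite in_fsetU hF ?orbT.
    move=> [[Sy xy] [_ xy']]; split=> // h.
    by rewrite in_fsetU => /orP[]; [exact: xy|exact: xy'].
- move=> _ [F _ <-]; apply: closedI => //.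
  by apply: finite_window_closed_preimage => //; exact: closed_agree.
- exists y; first by have [] := Xy (X fset0) (imageT _ _).
  apply/esym/funext => h; have [_] := Xy (X [fset h]%fset) (imageT _ _).
  by apply; rewrite inE.
Qed.

(** * Subspaces in finite dimension *)

(** A subspace of maximal dimension inside [S] exhausts it, since any further vector of [S] would
    enlarge it. *)
Lemma submod_closed_vspace (K : fieldType) (V : vectType K) (S : set V) :
  submod_closed (mem S) -> exists U : {vspace V}, forall x, S x <-> x \in U.
Proof.
move=> [S0 lS].
pose P n := `[< exists U : {vspace V}, \dim U = n /\ forall x, x \in U -> S x >].
have exP : exists n, P n.
  exists 0%N; apply/asboolP; exists 0%VS; rewrite dimv0; split=> // x.
  by rewrite memv0 => /eqP ->; exact/set_mem.
have boundP n : P n -> (n <= \dim {:V})%N.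
  by move=> /asboolP[U [<- _]]; exact/dimvS/subvf.
case: (ex_maxnP exP boundP) => n /asboolP[U [dU US]] maxn; exists U => x.
split=> [Sx|]; last exact: US.
have /maxn : P (\dim (<[x]> + U)).
  apply/asboolP; exists (<[x]> + U)%VS; split=> //.
  move=> _ /memv_addP[_ /vlineP[k ->] [v Uv ->]].
  by apply/set_mem; apply: lS; apply/mem_set => //; exact: US.
rewrite -dU (geq_leqif (dimv_leqif_sup (addvSr _ _))) => xU.
by apply: (subvP xU); apply: (subvP (addvSl _ _)); exact: memv_line.
Qed.

(** A member of least dimension works: directedness puts a member inside it and any given other one,
    and equality of dimensions makes the two nested members coincide. *)
Lemma directed_submod_min (K : fieldType) (V : vectType K) (I : Type) (i0 : I)
    (S : I -> set V) :
  (forall i, submod_closed (mem (S i))) ->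
  (forall i j, exists k, S k `<=` S i `&` S j) ->
  exists i, forall j, S i `<=` S j.
Proof.
move=> sS dS; have /choice[U US] := fun i => submod_closed_vspace (sS i).
have exP : exists n, `[< exists i, \dim (U i) = n >].
  by exists (\dim (U i0)); apply/asboolP; exists i0.
case: (ex_minnP exP) => n /asboolP[i <-] mini; exists i => j x /US xi.
have [k kij] := dS i j.
have ki : (U k <= U i)%VS by apply/subvP => y /US/kij[/US].
have dki : (\dim (U i) <= \dim (U k))%N by apply: mini; apply/asboolP; exists k.
have : (U i <= U k)%VS by rewrite -(geq_leqif (dimv_leqif_sup ki)).
by move=> /subvP/(_ _ xi)/US/kij[].
Qed.

(** * Linear cellular automata and their iterated images *)

Lemma linear_ca_linear (G : groupType) (K : fieldType) (A : vectType K)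
    (t : config G A -> config G A) :
  linear_ca t -> linear t.
Proof.
move=> [M [mu tE]] a x y; apply/funext => g.
rewrite [RHS](_ : _ = a *: t x g + t y g)// !tE -linearP; congr (mu _).
Qed.

Lemma linear_ca_window (G : groupType) (K : fieldType) (A : vectType K)
    (t : config G A -> config G A) :
  linear_ca t -> finite_window t.
Proof.
move=> [M [mu tE]] F; exists [fset (g * m)%g | g in F, m in M]%fset.
move=> x y xy g gF; rewrite !tE; congr (mu _); apply/funext => m.
rewrite /restr /shift invgK; apply: xy; apply/imfset2P.
by exists g => //; exists (val m) => //; exact: valP.
Qed.

Lemma linear_ca_shift (G : groupType) (K : fieldType) (A : vectType K)
    (t : config G A -> config G A) (g : G) (x : config G A) :
  linear_ca t -> t (shift g x) = shift g (t x).
Proof.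
move=> [M [mu tE]]; apply/funext => h; rewrite /shift !tE; congr (mu _).
by apply/funext => m; rewrite /restr /shift !invgK mulgA.
Qed.
Lemma linear_subshift_image (G : groupType) (K : fieldType) (A : vectType K)
    (t : config G A -> config G A) (S : set (config G A)) :
  linear_ca t -> linear_subshift S -> linear_subshift (t @` S).
Proof.
move=> ct [cS gS sS]; split.
- apply: closed_linear_image => //; [exact: linear_ca_linear| |].
    exact: linear_ca_window.
  exact: submod_affine.
- move=> g _ [x Sx <-]; exists (shift g x); first exact: gS.
  exact: linear_ca_shift.
- by apply: submod_image => //; exact: linear_ca_linear.
Qed.

Lemma linear_subshift_iter_image (G : groupType) (K : fieldType)
    (A : vectType K) (t : config G A -> config G A) (S : set (config G A)) n :
  linear_ca t -> linear_subshift S -> linear_subshift (iter n t @` S).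
Proof.
move=> ct sS; elim: n => [|n IH]; first by rewrite image_id.
rewrite (_ : iter n.+1 t @` S = t @` (iter n t @` S)); last first.
  by rewrite -image_comp.
exact: linear_subshift_image.
Qed.

Lemma linear_subshift_bigcap (G : groupType) (K : fieldType) (A : vectType K)
    (I : Type) (X : I -> set (config G A)) :
  (forall i, linear_subshift (X i)) -> linear_subshift (\bigcap_i X i).
Proof.
move=> sX; split.
- by apply: closed_bigI => i _; have [] := sX i.
- by move=> g x Xx i _; have [_ + _] := sX i; apply; exact: Xx.
- split; first by apply/mem_set => i _; have [_ _ [/set_mem]] := sX i.
  move=> a x y /set_mem Xx /set_mem Xy; apply/mem_set => i _.
  have [_ _ [_ lX]] := sX i.
  by apply/set_mem; apply: lX; apply/mem_set; [exact: Xx|exact: Xy].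
Qed.

Lemma iter_image_decreasing (T : Type) (t : T -> T) (S : set T) n :
  (forall x, S x -> S (t x)) -> iter n.+1 t @` S `<=` iter n t @` S.
Proof.
by move=> tS _ [x Sx <-]; exists (t x); [exact: tS|rewrite -iterSr].
Qed.

Lemma closed_config1 (G A : choiceType) (x : config G A) : closed [set x].
Proof.
apply/config_closedP => y yx; apply/funext => h.
by have [_ -> ->] := yx [fset h]%fset; rewrite ?inE.
Qed.

Lemma affine1 (K : fieldType) (V : lmodType K) (x : V) : affine [set x].
Proof. by move=> k _ _ _ -> -> ->; rewrite subrr scaler0 addr0. Qed.

Lemma iter_image_bigcap_onto (G : groupType) (K : fieldType) (A : vectType K)
    (t : config G A -> config G A) (S : set (config G A)) x :
  linear_ca t -> linear_subshift S -> (forall x, S x -> S (t x)) ->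
  (\bigcap_n (iter n t @` S)) x ->
  exists2 y, (\bigcap_n (iter n t @` S)) y & t y = x.
Proof.
move=> ct sS tS Sx.
have [||||y Xy] :=
    @config_closed_decreasing_meet G K A
      (fun n => iter n t @` S `&` t @^-1` [set x]).
- move=> n; apply: closedI.
    by have [] := linear_subshift_iter_image n ct sS.
  apply: finite_window_closed_preimage; first exact: linear_ca_window.
  exact: closed_config1.
- move=> n; apply: affineI.
    have [_ _] := linear_subshift_iter_image n ct sS; exact: submod_affine.
  by apply: affine_preimage; [exact: linear_ca_linear|exact: affine1].
(* A preimage of [x] in the [n]-th image comes from writing [x] as an iterate of order [n.+1]. *)
- by move=> n; have [y Sy <-] := Sx n.+1 I; exists (iter n t y); split.
- by move=> n y [Sy ty]; split=> //; exact: iter_image_decreasing Sy.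
- by exists y; [move=> n _|]; [have [] := Xy n|have [] := Xy 0%N].
Qed.

(** * Finite type and finite dimension *)

(* The restrictions to a finite window stabilise by dimension, and compactness
   lifts the stable restrictions to the intersection. *)
Lemma decreasing_subshift_window (G : groupType) (K : fieldType)
    (A : vectType K) (X : nat -> set (config G A)) (D : {fset G}) :
  (forall n, linear_subshift (X n)) -> (forall n, X n.+1 `<=` X n) ->
  exists n, forall y, X n y ->
    exists2 z, (\bigcap_m X m) z & forall h, h \in D -> y h = z h.
Proof.
move=> sX decX.
(* Finite functions form a [vectType], to which the dimension argument applies. *)
pose r (x : config G A) : {ffun D -> A} := [ffun d => x (val d)].
have lr : linear r by move=> a x y; apply/ffunP => d; rewrite !ffunE.
have dec := decreasing_subset decX.
have [||n Xn] := @directed_submod_min K {ffun D -> A} nat 0%N (fun n => r @` X n).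
- by move=> n; apply: submod_image => //; have [] := sX n.
- move=> i j; exists (maxn i j); rewrite subsetI; split; apply: image_subset.
    by apply: dec; exact: leq_maxl.
  by apply: dec; exact: leq_maxr.
exists n => y Xy.
have [||||z Xz] := @config_closed_decreasing_meet G K A
    (fun m => X m `&` [set z | forall h, h \in D -> y h = z h]).
- by move=> m; apply: closedI; [have [] := sX m|exact: closed_agree].
- move=> m; apply: affineI; last exact: affine_agree.
  by have [_ _] := sX m; exact: submod_affine.
- move=> m; have /(Xn m)[z Xz rz] : (r @` X n) (r y) by exists y.
  exists z; split=> // h hD.
  by have /ffunP/(_ [` hD]%fset) := rz; rewrite !ffunE.
- by move=> m z [Xz yz]; split=> //; exact: decX.
- by exists z; [move=> m _|]; [have [] := Xz m|have [] := Xz 0%N].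
Qed.

(** Shift invariance brings every window of a point of [X n] to [D], where the point agrees with one
    of the intersection and hence shows an allowed pattern. *)
Lemma decreasing_subshift_finite_type (G : groupType) (K : fieldType)
    (A : vectType K) (X : nat -> set (config G A)) :
  (forall n, linear_subshift (X n)) -> (forall n, X n.+1 `<=` X n) ->
  of_finite_type (\bigcap_n X n) -> exists n, X n `<=` \bigcap_m X m.
Proof.
move=> sX decX [D [P OmegaE]].
have [n Xn] := decreasing_subshift_window D sX decX.
exists n => x Xx; rewrite OmegaE => g /=.
have [_ gX _] := sX n.
have [z Oz xz] := Xn _ (gX g^-1%g x Xx).
have := Oz; rewrite OmegaE => /(_ 1%g); congr P.
apply/funext => d; rewrite /restr xz; last exact: valP.
by rewrite /shift invgK mul1g.
Qed.

(** The coefficient vectors whose combination vanishes on [D] form a directed family of subspaces of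
    a finite-dimensional space. Those in the smallest one give combinations that vanish everywhere,
    even if [b] is dependent. *)
Lemma finite_dimensional_window (G : choiceType) (K : fieldType)
    (A : vectType K) (S : set (config G A)) :
  finite_dimensional S ->
  exists D : {fset G}, forall x, S x -> (forall h, h \in D -> x h = 0) -> x = 0.
Proof.
move=> [n [b ->]].
pose L (c : 'rV[K]_n) : config G A := \sum_i c 0 i *: b i.
have lL : linear L.
  move=> a u v; rewrite /L scaler_sumr -big_split; apply: eq_bigr => i _.
  by rewrite !mxE scalerDl scalerA.
have L0 : L 0 = 0 by rewrite /L big1// => i _; rewrite mxE scale0r.
have [||D Dmin] := @directed_submod_min K 'rV[K]_n {fset G} fset0
    (fun D => [set c | forall h, h \in D -> L c h = 0]).
- move=> D; split; first by apply/mem_set => h _; rewrite L0.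
  move=> a u v /set_mem u0 /set_mem v0; apply/mem_set => h hD /=.
  rewrite lL [LHS](_ : _ = a *: L u h + L v h)// u0// v0//.
  by rewrite scaler0 addr0.
- move=> D D'; exists (D `|` D')%fset => c c0.
  by split=> h hD; apply: c0; rewrite in_fsetU hD ?orbT.
exists D => _ [c _ <-].
have -> : \sum_i c i *: b i = L (\row_i c i).
  by apply: eq_bigr => i _; rewrite mxE.
move=> c0; apply/funext => h.
by apply: (Dmin [fset h]%fset _ c0); rewrite inE.
Qed.

(* If [x] agrees with [z g] in [S] on the window translated by [g], then for a
   generator [s] the configurations [z g] and [z (g * s)] agree on a translate
   of [D], on which [S] is determined: so [z] is constant. *)
Lemma finite_dimensional_finite_type (G : groupType) (K : fieldType)
    (A : vectType K) (S : set (config G A)) :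
  finitely_generated G -> linear_subshift S -> finite_dimensional S ->
  of_finite_type S.
Proof.
move=> [Q finQ genQ] [cS gS [_ lS]] /finite_dimensional_window[D D0].
have Dinj x y : S x -> S y -> (forall h, h \in D -> x h = y h) -> x = y.
  move=> Sx Sy xy; apply/eqP; rewrite -subr_eq0; apply/eqP/D0.
    apply/set_mem; rewrite -scaleN1r addrC; apply: lS; exact/mem_set.
  move=> h hD; rewrite [LHS](_ : _ = x h - y h)// xy// subrr//.
(* [D] and its translates by generators let neighbouring windows be compared; the neutral element
   allows [x h] to be read off from [z h]. *)
pose W := (D `|` (1%g |` [fset (s * d)%g | s in fset_set Q, d in D]))%fset.
exists W, (restr W @` S); apply/seteqP; split=> [x Sx g|x Wx].
  by exists (shift g^-1%g x) => //; exact: gS.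
have /choice[z zx] : forall g, exists z, S z /\
    forall h, h \in W -> x (g * h)%g = z (g * h)%g.
  move=> g; have [z Sz zx] := Wx g; exists (shift g z); split; first exact: gS.
  move=> h hW; have := congr1 (fun f => f [` hW]%fset) zx.
  by rewrite /restr /shift /= invgK mulKg => ->.
have zD g s : Q s -> z (g * s)%g = z g.
  move=> Qs.
  have [Sg xg] := zx g; have [Sgs xgs] := zx (g * s)%g.
  have : shift (g * s)^-1%g (z (g * s)%g) = shift (g * s)^-1%g (z g).
    apply: Dinj; [exact: gS|exact: gS|move=> d dD; rewrite /shift invgK].
    rewrite -xgs; last by rewrite /W !inE dD.
    rewrite -mulgA -xg// /W; apply/fsetUP; right; apply/fsetUP; right.
    apply/imfset2P; exists s; first by rewrite /= in_fset_set// inE.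
    by exists d.
  move=> /(congr1 (shift (g * s)%g)) e; apply/funext => h.
  have := congr1 (fun f => f h) e.
  by rewrite /shift invgK !mulVKg.
(* The right periods of [z] form a subgroup containing the generators. *)
have zC h g : z (g * h)%g = z g.
  have : [set h | forall g, z (g * h)%g = z g] h; last exact.
  rewrite (genQ [set h | forall g, z (g * h)%g = z g])//.
  - split; first by apply/mem_set => g' /=; rewrite mulg1.
    move=> u v /set_mem zu /set_mem zv; apply/mem_set => g' /=.
    by rewrite -[LHS]zv mulgA mulgVK zu.
  - by move=> s Qs g' /=; exact: zD.
suff -> : x = z 1%g by have [] := zx 1%g.
apply/funext => h; have [_ zxh] := zx h.
rewrite -(zC h) mul1g -{3}(mulg1 h) -zxh ?mulg1//.
by rewrite /W !inE eqxx orbT.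
Qed.

(** * Recurrence and chains *)

Lemma subtype_entourageP (G A : choiceType) (S : set (config G A))
    (E : set (S * S)) :
  entourage E <-> exists F : {fset G},
    [set xy | forall h, h \in F -> set_val xy.1 h = set_val xy.2 h] `<=` E.
Proof.
split.
  case=> V /config_entourageP[F FV] VE; exists F => xy xyF; apply: VE.
  exact: FV.
case=> F FE; exists [set xy | forall h, h \in F -> xy.1 h = xy.2 h].
  by apply/config_entourageP; exists F.
exact: FE.
Qed.

Lemma subtype_nbhs_agree (G A : choiceType) (S : set (config G A))
    (x : S) (F : {fset G}) :
  nbhs x [set y : S | forall h, h \in F -> set_val x h = set_val y h].
Proof.
apply/nbhsP.
exists [set xy : S * S | forall h, h \in F -> set_val xy.1 h = set_val xy.2 h].
  by apply/subtype_entourageP; exists F.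
by move=> y; rewrite /xsection /= inE.
Qed.

Lemma Per_recurrent (X : topologicalType) (f : X -> X) :
  Per f `<=` recurrent f.
Proof.
by move=> x [n n1 fx] U Ux; exists n => //; rewrite fx; exact: nbhs_singleton.
Qed.

Lemma recurrent_nonwandering (X : topologicalType) (f : X -> X) :
  recurrent f `<=` nonwandering f.
Proof.
move=> x Rx U Ux; have [n n1 Ufx] := Rx U Ux; exists n => //.
by exists (iter n f x); split=> //; exists x => //; exact: nbhs_singleton.
Qed.

(** An orbit that starts and returns near [x] becomes a chain once both ends are replaced by [x]:
    agreement on [F'] absorbs the change at the start, agreement on [F] the one at the end. *)
Lemma nonwandering_chain_recurrent (G A : choiceType) (S : set (config G A))
    (tau : S -> S) (t : config G A -> config G A) :
  finite_window t -> (forall x, set_val (tau x) = t (set_val x)) ->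
  nonwandering tau `<=` chain_recurrent tau.
Proof.
move=> wt tauE x NWx E /subtype_entourageP[F FE].
have [F' tF'] := wt F.
have [n n1 [_ [[y /= xy <-] xny]]] := NWx _ (subtype_nbhs_agree x (F `|` F')%fset).
exists n, (fun i => if (i == 0%N) || (i == n) then x else iter i tau y).
split=> //; first by rewrite eqxx orbT.
move=> i ltin; apply: FE => /= h hF.
have -> : set_val (tau (if (i == 0%N) || (i == n) then x else iter i tau y)) h
    = set_val (iter i.+1 tau y) h.
  rewrite (ltn_eqF ltin) orbF; case: eqP => [->|//] /=.
  by rewrite !tauE; apply: tF' => // k kF; apply: xy; rewrite in_fsetU kF orbT.
by case: (i.+1 =P n) => [->|//]; rewrite xny// in_fsetU hF.
Qed.

Lemma chain_recurrent_range (G A : choiceType) (S : set (config G A))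
    (tau : S -> S) (t : config G A -> config G A) (x : S) n :
  finite_window t -> (forall x, set_val (tau x) = t (set_val x)) ->
  closed (iter n t @` S) -> chain_recurrent tau x ->
  (iter n t @` S) (set_val x).
Proof.
move=> wt tauE cT CRx; apply: (config_closedP _).1 cT _ _ => F.
(* [E] is so large that [n] steps of a chain with jumps invisible on [E] compute, on [F], the exact
   [n]-th iterate of its start. *)
have [E EF] : exists E : {fset G}, forall c : nat -> S,
    (forall i, forall h, h \in E -> set_val (tau (c i)) h = set_val (c i.+1) h) ->
    forall h, h \in F -> iter n t (set_val (c 0%N)) h = set_val (c n) h.
  elim: n F => [|n IH] F; first by exists fset0.
  have [F' tF'] := wt F; have [E EF'] := IH F'.
  exists (E `|` F)%fset => c cE h hF /=.
  rewrite -(cE n) ?in_fsetU ?hF ?orbT// tauE; apply: tF' => // k kF'.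
  by apply: EF' => // i j jE; rewrite cE// in_fsetU jE.
have [|m [c [m1 c0 cm cE]]] :=
    CRx [set xy | forall h, h \in E -> set_val xy.1 h = set_val xy.2 h].
  by apply/subtype_entourageP; exists E.
(* The chain is closed, so it repeats periodically and may be taken
   arbitrarily long; it is started [n] steps before a visit to [x]. *)
pose c' i := c ((i + (n * m - n)) %% m)%N.
have c'E i h : h \in E -> set_val (tau (c' i)) h = set_val (c' i.+1) h.
  move=> hE; rewrite {1}/c'; set r := (_ %% m)%N.
  have -> : c' i.+1 = c (r.+1 %% m)%N.
    by rewrite /c' addSn -[in RHS]addn1 modnDml addn1.
  have rm : (r < m)%N by rewrite ltn_mod.
  rewrite (cE r rm h hE); have [rm'|mr] := ltnP r.+1 m.
    by rewrite modn_small.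
  have -> : r.+1 = m by apply/eqP; rewrite eqn_leq rm mr.
  by rewrite modnn c0 cm.
(* The offset [n * m - n] makes the index at [n] a multiple of [m]. *)
have c'n : c' n = x.
  by rewrite /c' subnKC ?leq_pmulr// modnMl.
exists (iter n t (set_val (c' 0%N))).
  by exists (set_val (c' 0%N)) => //; exact: set_valP.
by move=> h hF; rewrite (EF c')// c'n.
Qed.

(** * Passage from the subtype to the full shift *)

Lemma set_val_iter (T : Type) (S : set T) (tau : S -> S) (t : T -> T) n x :
  (forall x, set_val (tau x) = t (set_val x)) ->
  set_val (iter n tau x) = iter n t (set_val x).
Proof. by move=> tauE; elim: n => //= n <-. Qed.

Lemma range_iterE (T : Type) (S : set T) (tau : S -> S) (t : T -> T) n x :
  (forall x, set_val (tau x) = t (set_val x)) ->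
  range (iter n tau) x <-> (iter n t @` S) (set_val x).
Proof.
move=> tauE; split=> [[y _ <-]|[y Sy tyx]].
  by exists (set_val y); [exact: set_valP|rewrite (set_val_iter _ _ tauE)].
exists (SigSub (mem_set Sy)) => //; apply: val_inj.
by rewrite [LHS](set_val_iter _ _ tauE).
Qed.

(** The extra index 0 on the right only demands membership in [S], which [set_val x] has. *)
Lemma limit_setE (T : Type) (S : set T) (tau : S -> S) (t : T -> T) x :
  (forall x, set_val (tau x) = t (set_val x)) ->
  limit_set tau x <-> (\bigcap_n (iter n t @` S)) (set_val x).
Proof.
move=> tauE; split=> [Ox [|n] _|Ox n _].
- by rewrite image_id; exact: set_valP.
- by apply/(range_iterE _ _ tauE); exact: Ox.
- by apply/(range_iterE _ _ tauE); exact: Ox.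
Qed.

Theorem theorem1p5 (G : groupType) (K : fieldType) (A : vectType K)
    (Sigma : set (config G A)) (tau : Sigma -> Sigma) :
  finitely_generated G ->
  linear_subshift Sigma ->
  linear_ca_on tau ->
  let Omega : set Sigma := limit_set tau in
  let OmegaG : set (config G A) := set_val @` Omega in
  [/\ linear_subshift OmegaG,
      tau @` Omega = Omega,
      [/\ Per tau `<=` recurrent tau,
          recurrent tau `<=` nonwandering tau,
          nonwandering tau `<=` chain_recurrent tau &
          chain_recurrent tau `<=` Omega],
      of_finite_type OmegaG -> stable tau &
      finite_dimensional OmegaG -> stable tau].
Proof.
move=> fgG sS [t ct tauE] Omega OmegaG.
have tS x : Sigma x -> Sigma (t x).
  by move=> Sx; rewrite -(tauE (SigSub (mem_set Sx))); exact: set_valP.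
have sT n := linear_subshift_iter_image n ct sS.
have decT n := iter_image_decreasing (n := n) tS.
have OmegaGE : OmegaG = \bigcap_n (iter n t @` Sigma).
  apply/seteqP; split=> [_ [x Ox <-]|x Ox]; first exact/(limit_setE _ tauE).
  (* The term of index 0 is [Sigma] itself, so [x] lifts to the subtype. *)
  have [y Sy yx] := Ox 0%N I; rewrite -yx /=.
  exists (SigSub (mem_set Sy)) => //; apply/(limit_setE _ tauE).
  by rewrite [set_val _]yx.
have sO : linear_subshift OmegaG.
  by rewrite OmegaGE; exact: linear_subshift_bigcap.
have ftO : of_finite_type OmegaG -> stable tau.
  rewrite OmegaGE => /(decreasing_subshift_finite_type sT decT)[n nO].
  (* The successor meets the bound [1 <= n] in [stable]; the image of order [n.+1] lies in that of
     order [n], hence in the limit set, hence in the image of order [n.+2]. *)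
  exists n.+1 => //; apply/seteqP; split=> x /(range_iterE _ _ tauE) Tx;
    apply/(range_iterE _ _ tauE); first exact: decT.
  exact: nO (decT _ _ Tx) n.+2 I.
split=> //; last by move=> /(finite_dimensional_finite_type fgG sO).
  apply/seteqP; split=> [_ [x Ox <-]|x /(limit_setE _ tauE) Ox].
    move=> n n1; have [y _ <-] := Ox n n1; exists (tau y) => //.
    by rewrite -iterSr.
  have [y Oy tyx] := iter_image_bigcap_onto ct sS tS Ox.
  have [y' Sy' yy'] := Oy 0%N I; move: yy' Oy tyx => /= <- Oy tyx.
  exists (SigSub (mem_set Sy')); first exact/(limit_setE _ tauE).
  by apply: val_inj; rewrite [LHS]tauE.
have wt := linear_ca_window ct.
split; [exact: Per_recurrent|exact: recurrent_nonwandering| |].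
  exact: nonwandering_chain_recurrent wt tauE.
move=> x CRx; apply/(limit_setE _ tauE) => n _.
by apply: chain_recurrent_range wt tauE _ CRx; have [] := sT n.
Qed.
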